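(* Let $\mathbf{X}=\{\mathbf{x}_1,\dots,\mathbf{x}_N\}\subset\mathbb{R}^n$ be data points with weights $w_1,\dots,w_N>0$, and let $1\le K\le N$ be an integer. The running time of Algorithm PCM($\ell_1$) is $$O\big(NK(K^2+n)I\big),$$ where $n$ is the dimension of the space, $N$ the number of points, $K$ the number of clusters, and $I$ the number of iterations.
   Context: Running time is measured by the number of elementary operations (arithmetic operations, powers and comparisons of real numbers). The $\ell_1$-distance on $\mathbb{R}^n$ is $d_1(\mathbf{x},\mathbf{y})=\sum_{j=1}^n|\mathbf{x}[j]-\mathbf{y}[j]|$, where $\mathbf{x}[j]$ is the $j$-th component of $\mathbf{x}$. Power probabilities. Given centers $\mathbf{c}_1,\dots,\mathbf{c}_K\in\mathbb{R}^n$ and an exponent $\nu\ge1$, $$p_k^{(\nu)}(\mathbf{x})=\frac{\prod_{j\ne k}d_1(\mathbf{x},\mathbf{c}_j)^\nu}{\sum_{\ell=1}^K\prod_{m\ne\ell}d_1(\mathbf{x},\mathbf{c}_m)^\nu},\quad k=1,\dots,K.$$ Weighted median. For real numbers $x_1\le\dots\le x_N$ with weights $u_1,\dots,u_N$, a weighted median is a point $x$ for which there exist $\alpha,\beta\ge0$ with $\sum\{u_i:x_i<x\}+\alpha=\sum\{u_i:x_i>x\}+\beta$, where $\alpha+\beta$ is the weight of $x$ if $x$ is one of the points, and $\alpha=\beta=0$ otherwise. Algorithm PCM($\ell_1$). Parameters: $\epsilon>0$ (stopping criterion), $\nu_0\ge1$ (initial exponent), $\Delta>0$ (increment). Initialization: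 arbitrary centers $\mathbf{c}_1,\dots,\mathbf{c}_K\in\mathbb{R}^n$ and $\nu:=\nu_0$. Iteration: Step 1: compute the distances $d_1(\mathbf{x}_i,\mathbf{c}_k)$ for all $i,k$. Step 2: compute the power probabilities $p_k^{(\nu)}(\mathbf{x}_i)$ for all $i,k$, using the formula displayed above. Step 3: compute new centers $\mathbf{c}_{k+}$, where for each $k\in\{1,\dots,K\}$ and $j\in\{1,\dots,n\}$ the component $\mathbf{c}_{k+}[j]$ is a weighted median of the points $\mathbf{x}_1[j],\dots,\mathbf{x}_N[j]$ with weights $w_i\,p_k^{(\nu)}(\mathbf{x}_i)$, i.e. a minimizer over $c\in\mathbb{R}$ of $\sum_{i=1}^N w_i\,p_k^{(\nu)}(\mathbf{x}_i)\,|\mathbf{x}_i[j]-c|$. Step 4: if $\sum_{k=1}^K d_1(\mathbf{c}_{k+},\mathbf{c}_k)<\epsilon$, stop; otherwise set $\nu:=\nu+\Delta$, replace each $\mathbf{c}_k$ by $\mathbf{c}_{k+}$, and return to Step 1. *)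

(* Defs.v *)
From mathcomp Require Import all_boot all_order all_algebra.
From mathcomp Require Import all_classical all_reals all_analysis.

Set Implicit Arguments.
Unset Strict Implicit.
Unset Printing Implicit Defensive.

Import Order.TTheory GRing.Theory Num.Theory.
Local Open Scope ring_scope.

Section Algorithm.
Variable R : realType.

Definition d1 n (x y : 'rV[R]_n) : R := \sum_(j < n) `|x 0 j - y 0 j|.

(* [0 / 0 = 0] when [x] coincides with two or more of the centers. *)
Definition power_prob n K (nu : R) (c : 'I_K -> 'rV[R]_n) (k : 'I_K)
    (x : 'rV[R]_n) : R :=
  (\prod_(j | j != k) d1 x (c j) `^ nu) /
  (\sum_(l < K) \prod_(m | m != l) d1 x (c m) `^ nu).

(* The weight of [y] is the total weight of the points located at [y]; this sum
   is empty, and so forces [alpha = beta = 0], when [y] is not one of them. *)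
Definition weighted_median N (x u : 'I_N -> R) (y : R) : Prop :=
  exists alpha beta : R,
    [/\ 0 <= alpha, 0 <= beta,
        \sum_(i | x i < y) u i + alpha = \sum_(i | y < x i) u i + beta
      & alpha + beta = \sum_(i | x i == y) u i].

Section Run.
Variables (n N K : nat) (X : 'I_N -> 'rV[R]_n) (w : 'I_N -> R) (eps Delta : R).

Definition center_update (nu : R) (c c' : 'I_K -> 'rV[R]_n) : Prop :=
  forall (k : 'I_K) (j : 'I_n),
    weighted_median (fun i => X i 0 j)
                    (fun i => w i * power_prob nu c k (X i)) (c' k 0 j).

(* [pcm_run nu c I h c']: from exponent [nu] and centers [c], the algorithm can
   perform [I] iterations and reach the centers [c']; [h] tells whether the
   stopping test has succeeded at the last of them.  This is a relation because
   weighted medians need not be unique. *)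
Inductive pcm_run :
    R -> ('I_K -> 'rV[R]_n) -> nat -> bool -> ('I_K -> 'rV[R]_n) -> Prop :=
| run_start nu c : pcm_run nu c 0 false c
| run_stop nu c c' :
    center_update nu c c' -> \sum_(k < K) d1 (c' k) (c k) < eps ->
    pcm_run nu c 1 true c'
| run_continue nu c c' I h c'' :
    center_update nu c c' -> ~~ (\sum_(k < K) d1 (c' k) (c k) < eps) ->
    pcm_run (nu + Delta) c' I h c'' -> pcm_run nu c I.+1 h c''.

End Run.
End Algorithm.

(* Programs over the reals.  A program sees real numbers only through the
   addresses of memory cells and the outcomes of comparisons, so that no
   information about the data can be obtained without paying for it.  Every
   computed number is stored in a fresh cell, whose address is passed on. *)
Definition addr := nat.

Inductive arith := Add | Sub | Mul | Div | Pow.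

Inductive prog (A : Type) : Type :=
| Ret of A
| Lit of nat & (addr -> prog A)
| Op of arith & addr & addr & (addr -> prog A)
| Less of addr & addr & (bool -> prog A).

Fixpoint bind A B (p : prog A) (f : A -> prog B) : prog B :=
  match p with
  | Ret a => f a
  | Lit z k => Lit z (fun c => bind (k c) f)
  | Op o a b k => Op o a b (fun c => bind (k c) f)
  | Less a b k => Less a b (fun t => bind (k t) f)
  end.

Notation "x <-- p ;; q" := (bind p (fun x => q))
  (at level 100, p at next level, right associativity).

Section Semantics.
Variable R : realType.

Definition arith_val (o : arith) (x y : R) : R :=
  match o with
  | Add => x + y
  | Sub => x - y
  | Mul => x * y
  | Div => x / y
  | Pow => x `^ y
  end.

(* The returned value, the final memory and the number of elementary operations
   (arithmetic operations, powers, comparisons); literals and control are free. *)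
Fixpoint exec A (p : prog A) (m : seq R) : A * seq R * nat :=
  match p with
  | Ret a => (a, m, 0%N)
  | Lit z k => exec (k (size m)) (rcons m z%:R)
  | Op o a b k =>
      let r := exec (k (size m)) (rcons m (arith_val o m`_a m`_b)) in
      (r.1, r.2.+1)
  | Less a b k =>
      let r := exec (k (m`_a < m`_b)) m in (r.1, r.2.+1)
  end.

Definition result A (p : prog A) (m : seq R) : A := (exec p m).1.1.
Definition memory A (p : prog A) (m : seq R) : seq R := (exec p m).1.2.
Definition time A (p : prog A) (m : seq R) : nat := (exec p m).2.

Definition holds (m : seq R) (a : addr) (v : R) : Prop := onth m a = Some v.

End Semantics.

Definition lit (z : nat) : prog addr := Lit z (@Ret addr).
Definition op (o : arith) (a b : addr) : prog addr := Op o a b (@Ret addr).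
Definition less (a b : addr) : prog bool := Less a b (@Ret bool).

Fixpoint fold_prog (o : arith) T (f : T -> prog addr) (s : seq T) (acc : addr) :
    prog addr :=
  if s is t :: s' then
    v <-- f t ;; a <-- op o acc v ;; fold_prog o f s' a
  else Ret acc.

Definition sum_prog T (s : seq T) (f : T -> prog addr) : prog addr :=
  z <-- lit 0 ;; fold_prog Add f s z.

Definition prod_prog T (s : seq T) (f : T -> prog addr) : prog addr :=
  z <-- lit 1 ;; fold_prog Mul f s z.

Fixpoint map_prog T A (f : T -> prog A) (s : seq T) : prog (seq A) :=
  if s is t :: s' then
    a <-- f t ;; r <-- map_prog f s' ;; Ret (a :: r)
  else Ret [::].

Definition table (T : finType) (f : T -> prog addr) : prog (T -> addr) :=
  s <-- map_prog f (enum T) ;; Ret (fun t => nth 0%N s (enum_rank t)).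

Definition abs_diff_prog (a b : addr) : prog addr :=
  t <-- less a b ;; if t then op Sub b a else op Sub a b.

Definition d1_prog n (x y : 'I_n -> addr) : prog addr :=
  sum_prog (enum 'I_n) (fun j => abs_diff_prog (x j) (y j)).

Definition power_product_prog K (nu : addr) (d : 'I_K -> addr) (k : 'I_K) :
    prog addr :=
  prod_prog [seq j <- enum 'I_K | j != k] (fun j => op Pow (d j) nu).

(* [d j] is the address of the distance from the point to the j-th center. *)
Definition power_prob_prog K (nu : addr) (d : 'I_K -> addr) (k : 'I_K) :
    prog addr :=
  num <-- power_product_prog nu d k ;;
  den <-- sum_prog (enum 'I_K) (power_product_prog nu d) ;;
  op Div num den.

Record pcm_output (n K : nat) := PcmOutput {
  iterations : nat;
  halted : bool;
  centers : 'I_K -> 'I_n -> addr }.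

Section PcmProgram.
(* The subroutine [wmed] is given the addresses of (point, weight) pairs. *)
Variable wmed : seq (addr * addr) -> prog addr.
Variables (n N K : nat) (X : 'I_N -> 'I_n -> addr) (w : 'I_N -> addr).
Variables (eps Delta : addr).

Definition center_update_prog (nu : addr) (c : 'I_K -> 'I_n -> addr) :
    prog ('I_K -> 'I_n -> addr) :=
  d <-- table (fun ik : 'I_N * 'I_K => d1_prog (X ik.1) (c ik.2)) ;;
  p <-- table (fun ik : 'I_N * 'I_K =>
                 power_prob_prog nu (fun j => d (ik.1, j)) ik.2) ;;
  u <-- table (fun ik : 'I_N * 'I_K => op Mul (w ik.1) (p ik)) ;;
  c' <-- table (fun kj : 'I_K * 'I_n =>
                  wmed [seq (X i kj.2, u (i, kj.1)) | i <- enum 'I_N]) ;;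
  Ret (fun k j => c' (k, j)).

(* The algorithm need not halt, so it is interrupted after [maxit] iterations. *)
Fixpoint pcm_prog (maxit : nat) (nu : addr) (c : 'I_K -> 'I_n -> addr) :
    prog (pcm_output n K) :=
  if maxit is maxit'.+1 then
    c' <-- center_update_prog nu c ;;
    s <-- sum_prog (enum 'I_K) (fun k => d1_prog (c' k) (c k)) ;;
    stop <-- less s eps ;;
    if stop then Ret (PcmOutput 1 true c')
    else
      nu' <-- op Add nu Delta ;;
      r <-- pcm_prog maxit' nu' c' ;;
      Ret (PcmOutput (iterations r).+1 (halted r) (centers r))
  else Ret (PcmOutput 0 false c).

End PcmProgram.

(* Main.v *)
Require Import Defs.
From mathcomp Require Import all_boot all_order all_algebra.
From mathcomp Require Import all_classical all_reals all_analysis.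
From mathcomp Require Import zify ring lra.
From Stdlib Require List.

Set Implicit Arguments.
Unset Strict Implicit.
Unset Printing Implicit Defensive.

Import Order.TTheory GRing.Theory Num.Theory.
Local Open Scope ring_scope.

(** One iteration costs [O(n)] for each of the [N * K] distances, [O(K ^ 2)] for
    each of the [N * K] probabilities, whose denominator is a sum of [K]
    products, and one weighted median of [N] points for each of the [K * n]
    components of the centers.  The bound [O(N * K * (K ^ 2 + n))] therefore
    holds as soon as a weighted median of [N] points can be found with [O(N)]
    operations, which excludes sorting the points.

    The weighted median is found by prune and search.  Given a pivot, the points
    on each side of it are weighed; either the pivot is a median, or one side is
    too heavy and contains a median, and the other points can be dropped once
    their total weight is remembered.  The search problem is accordingly stated
    with extra masses [l] and [r] lying to the left and to the right of all the
    points ([balanced], [balanced_lo], [balanced_hi], [spec_narrow]).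

    The cost is linear because of the choice of the pivot, namely the
    Blum-Floyd-Pratt-Rivest-Tarjan median of medians: the points are cut into
    [q] groups of five, and the pivot is the median of the [q] medians of these
    groups.  At least half of the medians are on either side of the pivot, and
    each of them brings three points of its group, so that at most
    [size s - 3 * q / 2] points survive ([spec_median_of_medians]).  Since a
    median is a weighted median for unit weights, the medians of the groups and
    the median of the medians are obtained by the same routine.  As
    [q + (size s - 3 * q / 2)] is smaller than [size s] by a fixed proportion, the
    recursion sums up to [288 * size s] operations ([wselect_selects]).

    Programs are verified by a Hoare logic in which a specification bounds the
    number of operations.  Memory only grows, so a known value of a cell is
    never lost ([grows]). *)

(** * Cost-aware Hoare logic for programs *)

Fixpoint partition_prog T (test : T -> prog bool) (s : seq T) :
    prog (seq T * seq T) :=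
  if s is t :: s' then
    b <-- test t ;; r <-- partition_prog test s' ;;
    Ret (if b then (t :: r.1, r.2) else (r.1, t :: r.2))
  else Ret ([::], [::]).

Section Logic.
Variable R : realType.
Implicit Types m : seq R.

Definition grows m m' := forall a v, holds m a v -> holds m' a v.

Lemma grows_refl m : grows m m.
Proof. by []. Qed.

Lemma grows_trans m1 m2 m3 : grows m1 m2 -> grows m2 m3 -> grows m1 m3.
Proof. by move=> h1 h2 a v /h1 /h2. Qed.

Lemma grows_rcons m v : grows m (rcons m v).
Proof.
move=> a w; rewrite /holds -cats1 onth_cat => h.
by have := onthTE m a; rewrite h /= => <-.
Qed.

Lemma holds_rcons m v : holds (rcons m v) (size m) v.
Proof. by rewrite /holds -cats1 onth_cat ltnn subnn. Qed.

Lemma holds_nth m a v : holds m a v -> m`_a = v.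
Proof. exact: onth_nth. Qed.

(** Keeping the exact time in the postcondition lets a bound depend on the
    result, as for a loop whose cost is proportional to the number of iterations
    performed; [spec] is the common case of a bound known beforehand. *)
Definition ensures A (p : prog A) m (Q : A -> seq R -> nat -> Prop) : Prop :=
  grows m (memory p m) /\ Q (result p m) (memory p m) (time p m).

Definition spec A (p : prog A) m (t : nat) (Q : A -> seq R -> Prop) : Prop :=
  ensures p m (fun a m' t' => (t' <= t)%N /\ Q a m').

Lemma exec_bind A B (p : prog A) (f : A -> prog B) m :
  exec (bind p f) m =
  let r := exec p m in let r' := exec (f r.1.1) r.1.2 in
  (r'.1, (r.2 + r'.2)%N).
Proof.
elim: p m => [a|z k IH|o a b k IH|a b k IH] m /=.
- by rewrite add0n -surjective_pairing.
- exact: IH.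
- by rewrite IH.
- by rewrite IH.
Qed.

Lemma ensures_bind A B (p : prog A) (f : A -> prog B) m Q1 Q2 :
  ensures p m Q1 ->
  (forall a m' t, grows m m' -> Q1 a m' t ->
     ensures (f a) m' (fun b m'' t' => Q2 b m'' (t + t')%N)) ->
  ensures (bind p f) m Q2.
Proof.
move=> [g1 h1] /(_ _ _ _ g1 h1) [g2 h2].
rewrite /ensures /memory /result /time exec_bind /=.
by split; first exact: grows_trans g2.
Qed.

Lemma ensures_ret A (a : A) m (Q : A -> seq R -> nat -> Prop) :
  Q a m 0%N -> ensures (Ret a) m Q.
Proof. by move=> q; split=> //; exact: grows_refl. Qed.

Lemma spec_bind A B (p : prog A) (f : A -> prog B) m t1 t2 t Q1 Q2 :
  spec p m t1 Q1 ->
  (forall a m', grows m m' -> Q1 a m' -> spec (f a) m' t2 Q2) ->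
  (t1 + t2 <= t)%N -> spec (bind p f) m t Q2.
Proof.
move=> h1 h2 le_t; apply: ensures_bind h1 _ => a m' t' gm [le1 q1].
have [g [le2 q2]] := h2 a m' gm q1; split=> //; split=> //.
by apply: leq_trans le_t; apply: leq_add.
Qed.

Lemma spec_ret A (a : A) m t (Q : A -> seq R -> Prop) :
  Q a m -> spec (Ret a) m t Q.
Proof. by move=> q; exact: ensures_ret. Qed.

Lemma spec_weaken A (p : prog A) m t t' (Q Q' : A -> seq R -> Prop) :
  spec p m t Q -> (t <= t')%N ->
  (forall a m', grows m m' -> Q a m' -> Q' a m') -> spec p m t' Q'.
Proof.
move=> [g [le q]] le' sub; split=> //; split; first exact: leq_trans le'.
exact: sub.
Qed.

Lemma spec_lit z m : spec (lit z) m 0 (fun a m' => holds m' a z%:R).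
Proof.
by split; [exact: grows_rcons | split=> //; exact: holds_rcons].
Qed.

Lemma spec_op o a b x y m : holds m a x -> holds m b y ->
  spec (op o a b) m 1 (fun c m' => holds m' c (arith_val o x y)).
Proof.
move=> /holds_nth ha /holds_nth hb.
split; first exact: grows_rcons.
by split=> //; rewrite -ha -hb; exact: holds_rcons.
Qed.

Lemma spec_less a b x y m : holds m a x -> holds m b y ->
  spec (less a b) m 1 (fun t _ => t = (x < y)).
Proof.
by move=> /holds_nth ha /holds_nth hb; split=> //; split=> //; rewrite -ha -hb.
Qed.

Lemma spec_fold o (T : eqType) (f : T -> prog addr) (v : T -> R) c s acc r m :
  holds m acc r ->
  (forall t m', t \in s -> grows m m' ->
     spec (f t) m' c (fun a m'' => holds m'' a (v t))) ->
  spec (fold_prog o f s acc) m (size s * c.+1)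
    (fun a m' => holds m' a (foldl (fun z t => arith_val o z (v t)) r s)).
Proof.
elim: s acc r m => [|t s IH] acc r m hacc hf; first exact: spec_ret.
have hft := hf t m (mem_head _ _) (grows_refl (m := m)).
rewrite /=; apply: (spec_bind (t2 := (1 + size s * c.+1)%N) hft); last by nia.
move=> a m1 g1 ha.
apply: (spec_bind (spec_op o (g1 _ _ hacc) ha) _ (leqnn _)) => b m2 g2 hb.
apply: IH => // t' m' s_t' g'.
apply: hf; first by rewrite inE s_t' orbT.
exact: grows_trans g1 (grows_trans g2 g').
Qed.

Lemma spec_sum_from (T : eqType) (f : T -> prog addr) (v : T -> R) c s acc r m :
  holds m acc r ->
  (forall t m', t \in s -> grows m m' ->
     spec (f t) m' c (fun a m'' => holds m'' a (v t))) ->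
  spec (fold_prog Add f s acc) m (size s * c.+1)
    (fun a m' => holds m' a (r + \sum_(t <- s) v t)).
Proof.
move=> hacc /(spec_fold Add hacc)/spec_weaken; apply=> // a m' _.
rewrite (_ : foldl _ _ _ = r + \sum_(t <- s) v t) //.
elim: s r {hacc} => [|t s IH] r /=; first by rewrite big_nil addr0.
by rewrite IH big_cons addrA.
Qed.

Lemma spec_sum (T : eqType) (f : T -> prog addr) (v : T -> R) c s m :
  (forall t m', t \in s -> grows m m' ->
     spec (f t) m' c (fun a m'' => holds m'' a (v t))) ->
  spec (sum_prog s f) m (size s * c.+1)
    (fun a m' => holds m' a (\sum_(t <- s) v t)).
Proof.
move=> hf; apply: (spec_bind (spec_lit 0 m) _ (leqnn _)) => a m' g ha.
have hf' t m'' : t \in s -> grows m' m'' ->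
     spec (f t) m'' c (fun a m'' => holds m'' a (v t)).
  by move=> s_t g'; apply: hf => //; exact: grows_trans g'.
by have := spec_sum_from ha hf'; rewrite add0r.
Qed.

Lemma spec_prod (T : eqType) (f : T -> prog addr) (v : T -> R) c s m :
  (forall t m', t \in s -> grows m m' ->
     spec (f t) m' c (fun a m'' => holds m'' a (v t))) ->
  spec (prod_prog s f) m (size s * c.+1)
    (fun a m' => holds m' a (\prod_(t <- s) v t)).
Proof.
move=> hf; apply: (spec_bind (spec_lit 1 m) _ (leqnn _)) => a m' g ha.
have hf' t m'' : t \in s -> grows m' m'' ->
     spec (f t) m'' c (fun a m'' => holds m'' a (v t)).
  by move=> s_t g'; apply: hf => //; exact: grows_trans g'.
apply: spec_weaken (spec_fold Mul ha hf') _ _ => // b m2 _.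
suff -> r : foldl (fun z t => arith_val Mul z (v t)) r s = r * \prod_(t <- s) v t.
  by rewrite mul1r.
elim: s r {hf hf'} => [|t s IH] r /=; first by rewrite big_nil mulr1.
by rewrite IH big_cons mulrA.
Qed.

(** A property established when an entry of a table is computed has to survive
    the writes made while the following entries are computed. *)
Definition stable T (Q : T -> addr -> seq R -> Prop) : Prop :=
  forall t a m m', grows m m' -> Q t a m -> Q t a m'.

Lemma spec_map (T : eqType) (f : T -> prog addr) (Q : T -> addr -> seq R -> Prop)
    c s m :
  stable Q ->
  (forall t m', t \in s -> grows m m' -> spec (f t) m' c (Q t)) ->
  spec (map_prog f s) m (size s * c)
    (fun r m' => List.Forall2 (fun t a => Q t a m') s r).
Proof.
move=> stQ; elim: s m => [|t s IH] m hf; first by apply: spec_ret; constructor.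
have hft := hf t m (mem_head _ _) (grows_refl (m := m)).
rewrite /=; apply: (spec_bind (t2 := (size s * c)%N) hft); last by nia.
move=> a m1 g1 ha.
apply: (spec_bind (IH m1 _) _ (t2 := 0%N)); last by rewrite addn0.
- move=> t' m' s_t' g'; apply: hf; first by rewrite inE s_t' orbT.
  exact: grows_trans g'.
- by move=> r m2 g2 hr; apply: spec_ret; constructor => //; exact: stQ ha.
Qed.

Lemma Forall2_nth T1 T2 (P : T1 -> T2 -> Prop) s r x0 y0 i :
  List.Forall2 P s r -> (i < size s)%N -> P (nth x0 s i) (nth y0 r i).
Proof.
by move=> h; elim: h i => [|x y s' r' pxy _ IH] [|i] //= /IH.
Qed.

Lemma spec_table (T : finType) (f : T -> prog addr) (Q : T -> addr -> seq R -> Prop)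
    c m :
  stable Q ->
  (forall t m', grows m m' -> spec (f t) m' c (Q t)) ->
  spec (table f) m (#|T| * c) (fun g m' => forall t, Q t (g t) m').
Proof.
move=> stQ hf.
apply: (spec_bind (t2 := 0%N) (spec_map stQ (fun t m' _ => hf t m'))).
  move=> r m' g hr; apply: spec_ret => t.
  rewrite -[in Q t](nth_enum_rank t t).
  by apply: Forall2_nth hr _; rewrite -cardE.
by rewrite addn0 cardE.
Qed.

Lemma spec_partition (T : eqType) (test : T -> prog bool) (P : pred T) c s m :
  (forall t m', t \in s -> grows m m' ->
     spec (test t) m' c (fun b _ => b = P t)) ->
  spec (partition_prog test s) m (size s * c)
    (fun r _ => r = ([seq t <- s | P t], [seq t <- s | ~~ P t])).
Proof.
elim: s m => [|t s IH] m hf; first exact: spec_ret.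
have hft := hf t m (mem_head _ _) (grows_refl (m := m)).
rewrite /=; apply: (spec_bind (t2 := (size s * c)%N) hft); last by nia.
move=> b m1 g1 ->.
apply: (spec_bind (IH m1 _) _ (t2 := 0%N)); last by rewrite addn0.
- move=> t' m' s_t' g'; apply: hf; first by rewrite inE s_t' orbT.
  exact: grows_trans g'.
- by move=> r m2 g2 ->; apply: spec_ret => /=; case: (P t).
Qed.

End Logic.

(** * Weighted median by prune and search *)

Definition routine := seq (addr * addr) -> addr -> addr -> prog addr.

(** The cells [l] and [r] hold the masses of the points already dropped on the
    left and on the right of [s].  Recursing on one side turns the mass of the
    pivot and of the other side into such an extra mass. *)
Definition narrow (rec : routine) (s : seq (addr * addr)) (l r piv : addr) :
    prog addr :=
  lo <-- partition_prog (fun p => less p.1 piv) s ;;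
  hi <-- partition_prog (fun p => less piv p.1) s ;;
  below <-- fold_prog Add (fun p => Ret p.2) lo.1 l ;;
  notbelow <-- fold_prog Add (fun p => Ret p.2) lo.2 r ;;
  above <-- fold_prog Add (fun p => Ret p.2) hi.1 r ;;
  notabove <-- fold_prog Add (fun p => Ret p.2) hi.2 l ;;
  go_lo <-- less notbelow below ;;
  if go_lo then rec lo.1 l notbelow
  else
    go_hi <-- less notabove above ;;
    if go_hi then rec hi.1 notabove r else Ret piv.

(** The at most four remaining entries are left out: this only weakens the
    quality of the pivot by a bounded amount. *)
Definition groups (s : seq addr) : seq (seq addr) :=
  reshape (nseq (size s %/ 5) 5) s.

Definition with_weight (one : addr) (s : seq addr) : seq (addr * addr) :=
  [seq (a, one) | a <- s].

Definition median_of_medians (rec : routine) (s : seq (addr * addr)) :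
    prog addr :=
  one <-- lit 1 ;; zero <-- lit 0 ;;
  meds <-- map_prog (fun g => rec (with_weight one g) zero zero)
                    (groups (unzip1 s)) ;;
  rec (with_weight one meds) zero zero.

(** The number of points bounds the depth of the recursion, since every recursive
    call is made on fewer points; [0%N] is a dummy address. *)
Fixpoint wselect (fuel : nat) (s : seq (addr * addr)) (l r : addr) :
    prog addr :=
  if fuel is fuel'.+1 then
    piv <-- (if (size s <= 5)%N then Ret (head 0%N (unzip1 s))
             else median_of_medians (wselect fuel') s) ;;
    narrow (wselect fuel') s l r piv
  else Ret 0%N.

Definition wmedian_prog (s : seq (addr * addr)) : prog addr :=
  zero <-- lit 0 ;; wselect (size s) s zero zero.

Section Selection.
Variable R : realType.
Implicit Types (m : seq R) (x u : addr -> R) (s : seq (addr * addr)).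

Definition mass x u (P : pred R) s : R := \sum_(p <- s | P (x p.1)) u p.2.

(** The weighted median condition for the points of [s] together with a mass [l]
    on their left and a mass [r] on their right, the two slacks of the
    definition being eliminated. *)
Definition balanced x u s (l r y : R) : Prop :=
  l + mass x u (fun z => z < y) s <= r + mass x u (fun z => y <= z) s /\
  r + mass x u (fun z => y < z) s <= l + mass x u (fun z => z <= y) s.

(** Values are described by two functions of addresses, one for points and one
    for weights: replacing all the weights by [1] then only replaces the second
    function. *)
Definition readable m x u s : Prop :=
  forall p, p \in s -> holds m p.1 (x p.1) /\ holds m p.2 (u p.2).

(** Up to five points, where the pivot is arbitrary, pruning may remove a single
    point at each step, hence the quadratic regime.  The constant [288] makes the
    linear regime self-sustaining: with [q] groups among [n] points,
    [90 * q + 288 * q + 6 * n + 288 * (n - 3 * q / 2) <= 288 * n] amounts to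
    [6 * n <= 54 * q], which holds because [n <= 5 * q + 4 <= 9 * q]. *)
Definition cost (n : nat) : nat :=
  (if n <= 5 then 3 * (n * n.+1) else 288 * n)%N.

(** The two inequalities on [l] and [r] say that neither extra mass outweighs
    everything else; otherwise the median would lie among the dropped points.
    The address returned is one of those given, so that the value it holds is
    one of the points, which makes the recursion progress. *)
Definition selects (rec : routine) (bound : nat) : Prop :=
  forall m x u s al ar l r, (0 < size s <= bound)%N -> readable m x u s ->
    holds m al l -> holds m ar r ->
    l <= r + mass x u xpredT s -> r <= l + mass x u xpredT s ->
    spec (rec s al ar) m (cost (size s))
      (fun a _ => a \in unzip1 s /\ balanced x u s l r (x a)).

Lemma readable_grows m m' x u s :
  grows m m' -> readable m x u s -> readable m' x u s.
Proof. by move=> g h p /h [h1 h2]; split; exact: g. Qed.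

Lemma readable_sub m x u s s' :
  {subset s' <= s} -> readable m x u s -> readable m x u s'.
Proof. by move=> sub h p /sub /h. Qed.

Lemma eq_mass x u (P P' : pred R) s : P =1 P' -> mass x u P s = mass x u P' s.
Proof. by move=> e; apply: eq_bigl => p; exact: e. Qed.

Lemma mass_filter x u (P P' : pred R) s :
  mass x u P [seq p <- s | P' (x p.1)] = mass x u (predI P' P) s.
Proof. by rewrite /mass big_filter_cond. Qed.

Lemma mass_split x u (P' P : pred R) s :
  mass x u P s = mass x u (predI P' P) s + mass x u (predI (predC P') P) s.
Proof.
rewrite /mass (bigID (fun p => P' (x p.1))) /=.
by congr (_ + _); apply: eq_bigl => p; rewrite andbC.
Qed.

(** For a candidate [y] below the cut [c], the points at or beyond [c] only matter
    through their total weight. *)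
Lemma balanced_lo x u s l r c y : y < c ->
  balanced x u [seq p <- s | x p.1 < c] l (r + mass x u (fun z => c <= z) s) y ->
  balanced x u s l r y.
Proof.
move=> yc; rewrite /balanced !(mass_filter x u _ (fun z => z < c)).
rewrite (mass_split x u (fun z => z < c) (fun z => y <= z) s).
rewrite (mass_split x u (fun z => z < c) (fun z => y < z) s).
rewrite (@eq_mass _ _ (predI (fun z => z < c) (fun z => z < y))
          (fun z => z < y)); last first.
  by move=> z /=; apply/andP/idP => [[]|zy] //; split=> //; apply: lt_trans yc.
rewrite (@eq_mass _ _ (predI (fun z => z < c) (fun z => z <= y))
          (fun z => z <= y)); last first.
  by move=> z /=; apply/andP/idP => [[]|zy] //; split=> //; apply: le_lt_trans yc.
rewrite (@eq_mass _ _ (predI (predC (fun z => z < c)) (fun z => y <= z))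
          (fun z => c <= z)); last first.
  by move=> z /=; rewrite -leNgt; apply/andP/idP => [[]|cz] //;
    split=> //; apply: ltW; apply: lt_le_trans cz.
rewrite (@eq_mass _ _ (predI (predC (fun z => z < c)) (fun z => y < z))
          (fun z => c <= z)); last first.
  by move=> z /=; rewrite -leNgt; apply/andP/idP => [[]|cz] //;
    split=> //; apply: lt_le_trans cz.
by move=> [h1 h2]; split; lra.
Qed.

Lemma balanced_hi x u s l r c y : c < y ->
  balanced x u [seq p <- s | c < x p.1] (l + mass x u (fun z => z <= c) s) r y ->
  balanced x u s l r y.
Proof.
move=> yc; rewrite /balanced !(mass_filter x u _ (fun z => c < z)).
rewrite (mass_split x u (fun z => c < z) (fun z => z <= y) s).
rewrite (mass_split x u (fun z => c < z) (fun z => z < y) s).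
rewrite (@eq_mass _ _ (predI (fun z => c < z) (fun z => y < z))
          (fun z => y < z)); last first.
  by move=> z /=; apply/andP/idP => [[]|zy] //; split=> //; apply: lt_trans zy.
rewrite (@eq_mass _ _ (predI (fun z => c < z) (fun z => y <= z))
          (fun z => y <= z)); last first.
  by move=> z /=; apply/andP/idP => [[]|zy] //; split=> //; apply: lt_le_trans zy.
rewrite (@eq_mass _ _ (predI (predC (fun z => c < z)) (fun z => z <= y))
          (fun z => z <= c)); last first.
  by move=> z /=; rewrite -leNgt; apply/andP/idP => [[]|cz] //;
    split=> //; apply: ltW; apply: le_lt_trans yc.
rewrite (@eq_mass _ _ (predI (predC (fun z => c < z)) (fun z => z < y))
          (fun z => z <= c)); last first.
  by move=> z /=; rewrite -leNgt; apply/andP/idP => [[]|cz] //;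
    split=> //; apply: le_lt_trans yc.
by move=> [h1 h2]; split; lra.
Qed.

Lemma mass_total x u (P : pred R) s :
  mass x u xpredT s = mass x u P s + mass x u (predC P) s.
Proof.
rewrite (mass_split x u P).
by congr (_ + _); apply: eq_mass => z /=; rewrite andbT.
Qed.

Lemma spec_weigh m x u s al l : readable m x u s -> holds m al l ->
  spec (fold_prog Add (fun p => Ret p.2) s al) m (size s)
    (fun a m' => holds m' a (l + mass x u xpredT s)).
Proof.
move=> rd hl.
have := @spec_sum_from R _ (fun p => Ret p.2) (fun p => u p.2) 0 s al l m hl.
rewrite muln1; apply => p m' s_p g; apply: spec_ret.
by apply: g; case: (rd p s_p).
Qed.

Lemma mass_gt0_size x u s : 0 < mass x u xpredT s -> (0 < size s)%N.
Proof. by case: s => //; rewrite /mass big_nil ltxx. Qed.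

Lemma mem_unzip1_filter (P : pred R) x s a :
  a \in unzip1 [seq p <- s | P (x p.1)] -> P (x a) /\ a \in unzip1 s.
Proof.
move=> /mapP [p]; rewrite mem_filter => /andP[Pp s_p] ->.
by split=> //; exact: map_f.
Qed.

Lemma size_filter_lt (P : pred R) x s a :
  a \in unzip1 s -> ~~ P (x a) ->
  (size [seq p <- s | P (x p.1)] < size s)%N.
Proof.
move=> /mapP [p s_p ->] nP.
rewrite size_filter -(count_predC (fun p => P (x p.1)) s) -addn1 leq_add2l.
by rewrite -has_count; apply/hasP; exists p.
Qed.

(** Correctness of a pruning step does not depend on the pivot, which only
    affects the numbers of points on its two sides, hence the cost.  A side that
    is too heavy is nonempty, and the invariant of [selects] holds there: one of
    its inequalities is the comparison just made, the other one is inherited. *)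
Lemma spec_narrow rec bound m x u s al ar l r a t :
  selects rec bound -> (size s <= bound.+1)%N -> readable m x u s ->
  holds m al l -> holds m ar r ->
  l <= r + mass x u xpredT s -> r <= l + mass x u xpredT s ->
  a \in unzip1 s ->
  (6 * size s + cost (count (fun p => (x p.1 < x a)%R) s) <= t)%N ->
  (6 * size s + cost (count (fun p => (x a < x p.1)%R) s) <= t)%N ->
  spec (narrow rec s al ar a) m t
    (fun b _ => b \in unzip1 s /\ balanced x u s l r (x b)).
Proof.
move=> hrec le_s rd hl hr le_l le_r sa t_lo t_hi.
have ha : holds m a (x a) by case/mapP: sa => p /rd[h _] ->.
pose lo := [seq p <- s | x p.1 < x a].
pose nlo := [seq p <- s | ~~ (x p.1 < x a)].
pose hi := [seq p <- s | x a < x p.1].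
pose nhi := [seq p <- s | ~~ (x a < x p.1)].
pose M := maxn (cost (size lo)) (cost (size hi)).
have size_lo : (size lo + size nlo = size s)%N
  by rewrite !size_filter count_predC.
have size_hi : (size hi + size nhi = size s)%N
  by rewrite !size_filter count_predC.
have sub (P : pred (addr * addr)) m' :
    grows m m' -> readable m' x u [seq p <- s | P p].
  move=> g; apply: readable_grows g _; apply: readable_sub rd.
  by move=> p; rewrite mem_filter => /andP[].
have test_lo p m' : p \in s -> grows m m' ->
    spec (less p.1 a) m' 1 (fun b _ => b = (x p.1 < x a)).
  by move=> /rd[hp _] g; apply: spec_less; exact: g.
have test_hi p m' : p \in s -> grows m m' ->
    spec (less a p.1) m' 1 (fun b _ => b = (x a < x p.1)).
  by move=> /rd[hp _] g; apply: spec_less; exact: g.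
have mnlo : mass x u xpredT nlo = mass x u (fun z => x a <= z) s.
  rewrite (mass_filter x u _ (fun z => ~~ (z < x a))).
  by apply: eq_mass => z /=; rewrite andbT leNgt.
have mnhi : mass x u xpredT nhi = mass x u (fun z => z <= x a) s.
  rewrite (mass_filter x u _ (fun z => ~~ (x a < z))).
  by apply: eq_mass => z /=; rewrite andbT leNgt.
have mlo : mass x u xpredT lo = mass x u (fun z => z < x a) s.
  rewrite (mass_filter x u _ (fun z => z < x a)).
  by apply: eq_mass => z /=; rewrite andbT.
have mhi : mass x u xpredT hi = mass x u (fun z => x a < z) s.
  rewrite (mass_filter x u _ (fun z => x a < z)).
  by apply: eq_mass => z /=; rewrite andbT.
have tot_lo : mass x u xpredT s = mass x u xpredT lo + mass x u xpredT nlo.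
  rewrite mlo mnlo (mass_total x u (fun z => z < x a)); congr (_ + _).
  by apply: eq_mass => z /=; rewrite leNgt.
have tot_hi : mass x u xpredT s = mass x u xpredT hi + mass x u xpredT nhi.
  rewrite mhi mnhi (mass_total x u (fun z => x a < z)); congr (_ + _).
  by apply: eq_mass => z /=; rewrite leNgt.
have lt_lo : (size lo < size s)%N.
  by apply: (@size_filter_lt (fun z => z < x a) x s a) => //; rewrite ltxx.
have lt_hi : (size hi < size s)%N.
  by apply: (@size_filter_lt (fun z => x a < z) x s a) => //; rewrite ltxx.
(* Two partitions, four sums, two comparisons and one recursive call. *)
apply: (@spec_weaken _ _ _ _
  (size s * 1 + (size s * 1 + (size lo + (size nlo +
    (size hi + (size nhi + (1 + (1 + M))))))))%N
  _ (fun b _ => b \in unzip1 s /\ balanced x u s l r (x b))) => //; last first.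
  move: t_lo t_hi; rewrite -!size_filter -/lo -/hi /M; lia.
apply: (spec_bind (spec_partition (P := fun p => x p.1 < x a) test_lo) _
  (leqnn _)) => _ m1 g1 ->.
have test_hi1 p m' : p \in s -> grows m1 m' ->
    spec (less a p.1) m' 1 (fun b _ => b = (x a < x p.1)).
  by move=> sp g; apply: test_hi => //; exact: grows_trans g.
apply: (spec_bind (spec_partition (P := fun p => x a < x p.1) test_hi1) _
  (leqnn _)) => _ m2 g2' -> /=.
have {g1 g2' m1 test_hi1} g2 := grows_trans g1 g2'.
rewrite -/lo -/nlo -/hi -/nhi.
apply: (spec_bind (spec_weigh (sub _ _ g2) (g2 _ _ hl)) _
  (leqnn _)) => below m3 g3' h3.
have g3 := grows_trans g2 g3'.
apply: (spec_bind (spec_weigh (sub _ _ g3) (g3 _ _ hr)) _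
  (leqnn _)) => notbelow m4 g4' h4.
have g4 := grows_trans g3 g4'; move/g4': h3 => h3.
apply: (spec_bind (spec_weigh (sub _ _ g4) (g4 _ _ hr)) _
  (leqnn _)) => above m5 g5' h5.
have g5 := grows_trans g4 g5'; move/g5': h3 => h3; move/g5': h4 => h4.
apply: (spec_bind (spec_weigh (sub _ _ g5) (g5 _ _ hl)) _
  (leqnn _)) => notabove m6 g6' h6.
have g6 := grows_trans g5 g6'.
move/g6': h3 => h3; move/g6': h4 => h4; move/g6': h5 => h5.
apply: (spec_bind (spec_less h4 h3) _ (leqnn _)) => _ m7 g7' ->.
have g7 := grows_trans g6 g7'.
move/g7': h3 => h3; move/g7': h4 => h4; move/g7': h5 => h5; move/g7': h6 => h6.
rewrite -/lo -/nlo in h3 h4; rewrite -/hi -/nhi in h5 h6.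
case: ifPn => [lt1|]; last rewrite -leNgt => ge1.
  have lo_gt0 : (0 < size lo)%N by apply: (@mass_gt0_size x u); lra.
  apply: (spec_weaken (hrec m7 x u lo al notbelow l _ _ (sub _ _ g7) (g7 _ _ hl)
    h4 _ _)); try lra.
  - by rewrite lo_gt0 /=; lia.
  - by rewrite /M; lia.
  - move=> b m8 g8 [/(mem_unzip1_filter (P := fun z => z < x a)) [blt sb] bal].
    by split=> //; apply: balanced_lo blt _; rewrite -mnlo.
apply: (spec_bind (spec_less h6 h5) _ (leqnn _)) => _ m8 g8' ->.
have g8 := grows_trans g7 g8'; move/g8': h6 => h6.
case: ifPn => [lt2|]; last rewrite -leNgt => ge2.
  have hi_gt0 : (0 < size hi)%N by apply: (@mass_gt0_size x u); lra.
  apply: (spec_weaken (hrec m8 x u hi notabove ar _ r _ (sub _ _ g8) h6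
    (g8 _ _ hr) _ _)); try lra.
  - by rewrite hi_gt0 /=; lia.
  - by rewrite /M; lia.
  - move=> b m9 g9 [/(mem_unzip1_filter (P := fun z => x a < z)) [bgt sb] bal].
    by split=> //; apply: balanced_hi bgt _; rewrite -mnhi.
apply: spec_ret; split=> //; rewrite /balanced -mlo -mhi -mnlo -mnhi; lra.
Qed.
Lemma flatten_groups (s : seq addr) : flatten (groups s) = take (size s %/ 5 * 5) s.
Proof.
rewrite /groups; move: (size s %/ 5)%N => q.
elim: q s => [|q IH] s; first by rewrite take0.
by rewrite mulSn takeD -IH.
Qed.

Lemma size_groups (s : seq addr) : size (groups s) = (size s %/ 5)%N.
Proof. by rewrite size_reshape size_nseq. Qed.

Lemma size_group (s : seq addr) g : g \in groups s -> size g = 5.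
Proof.
move=> s_g; have : size g \in shape (groups s) by exact: map_f.
rewrite /groups reshapeKl; first by rewrite mem_nseq => /andP[_ /eqP].
by rewrite sumn_nseq mulnC leq_trunc_div.
Qed.

Lemma mem_group (s : seq addr) g : g \in groups s -> {subset g <= s}.
Proof.
move=> s_g a g_a; apply: (@mem_take (size s %/ 5 * 5)).
by rewrite -flatten_groups; apply/flattenP; exists g.
Qed.

(** With unit weights, the median has at least half of the entries on each of its
    closed sides. *)
Lemma balanced_half x one (s : seq addr) y :
  balanced x (fun=> 1) (with_weight one s) 0 0 y ->
  (size s <= 2 * count (fun a => (y <= x a)%R) s)%N /\
  (size s <= 2 * count (fun a => (x a <= y)%R) s)%N.
Proof.
have massE (P : pred R) :
    mass x (fun=> 1) P (with_weight one s) = (count (fun a => P (x a)) s)%:R.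
  by rewrite /mass big_map -sum1_count natr_sum.
rewrite /balanced !massE !add0r !ler_nat => -[h1 h2]; split.
- rewrite -(count_predC (fun a => y <= x a) s) mul2n -addnn leq_add2l.
  apply: leq_trans h1; apply: eq_leq; apply: eq_count => a /=.
  by rewrite ltNge.
- rewrite -(count_predC (fun a => x a <= y) s) mul2n -addnn leq_add2l.
  apply: leq_trans h2; apply: eq_leq; apply: eq_count => a /=.
  by rewrite ltNge.
Qed.

(** For [P] the order or its converse: each group whose median lies beyond [y]
    contributes the three entries lying beyond its own median. *)
Lemma count_medians (P : rel R) x y gs meds :
  (forall z t, P y z -> P z t -> P y t) ->
  List.Forall2 (fun g b => 3 <= count (fun a => P (x b) (x a)) g)%N gs meds ->
  (3 * count (fun b => P y (x b)) meds
    <= count (fun a => P y (x a)) (flatten gs))%N.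
Proof.
move=> tr; elim=> [|g b gs' meds' h _ IH] //=.
rewrite count_cat mulnDr leq_add //.
case: (boolP (P y (x b))) => // yb.
by apply: leq_trans h (sub_count _ _) => a; apply: tr.
Qed.

Lemma cost_le n : (cost n <= 288 * n)%N.
Proof.
rewrite /cost; case: (leqP n 5) => // le5.
by have := leq_mul (leqnn n) (le5 : (n.+1 <= 6)%N); lia.
Qed.

(** Half of the [q] medians are on either closed side of the pivot, and each of
    them accounts for three points.  The constant [90] is [cost 5]. *)
Lemma spec_median_of_medians rec bound m x u s :
  selects rec bound -> (5 < size s <= bound.+1)%N -> readable m x u s ->
  spec (median_of_medians rec s) m (90 * (size s %/ 5) + cost (size s %/ 5))
    (fun a _ => [/\ a \in unzip1 s,
       (3 * (size s %/ 5) <= 2 * count (fun p => (x a <= x p.1)%R) s)%N &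
       (3 * (size s %/ 5) <= 2 * count (fun p => (x p.1 <= x a)%R) s)%N]).
Proof.
move=> hrec /andP[s_gt5 s_le] rd.
set q := (size s %/ 5)%N.
have q_gt0 : (0 < q)%N by rewrite /q; lia.
have q_le : (q <= bound)%N by rewrite /q; lia.
have rd1 m' one t : grows m m' -> holds m' one 1 -> {subset t <= unzip1 s} ->
    readable m' x (fun=> 1) (with_weight one t).
  move=> g h1 sub p /mapP [a /sub/mapP[p' s_p' ->] ->] /=; split=> //.
  by apply: g; case: (rd p' s_p').
have mass_ge0 t : 0 <= mass x (fun=> 1) xpredT t by apply: sumr_ge0.
rewrite (_ : (_ + _)%N =
    0 + (0 + (size (groups (unzip1 s)) * 90 + cost q)))%N; last first.
  by rewrite size_groups size_map mulnC.
rewrite /median_of_medians.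
apply: (spec_bind (spec_lit 1 m) _ (leqnn _)) => one m1 g1 h1.
apply: (spec_bind (spec_lit 0 m1) _ (leqnn _)) => zero m2 g2' h0.
have g2 := grows_trans g1 g2'; move/g2': h1 => h1.
pose Q g (b : addr) (_ : seq R) := b \in g /\
  (3 <= count (fun a => (x b <= x a)%R) g)%N /\
  (3 <= count (fun a => (x a <= x b)%R) g)%N.
have hQ g m' : g \in groups (unzip1 s) -> grows m2 m' ->
    spec (rec (with_weight one g) zero zero) m' 90 (Q g).
  move=> s_g g'; have size_g := size_group s_g.
  apply: (spec_weaken (hrec m' x (fun=> 1) _ zero zero 0 0 _ _ (g' _ _ h0)
    (g' _ _ h0) _ _)).
  - by rewrite size_map size_g /=; lia.
  - apply: rd1 (grows_trans g2 g') (g' _ _ h1) (mem_group s_g).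
  - by rewrite add0r.
  - by rewrite add0r.
  - by rewrite size_map size_g.
  - move=> b m3 _ [+ /balanced_half[]]; rewrite /unzip1 -map_comp map_id => g_b.
    by rewrite size_g; split=> //; split; lia.
apply: (spec_bind (spec_map (Q := Q) _ hQ) _ (leqnn _)) => [//|meds m3 g3 hmeds].
have size_meds : size meds = q.
  suff -> : size meds = size (groups (unzip1 s)) by rewrite size_groups size_map.
  by elim: hmeds => //= g b gs ms _ _ ->.
have sub_meds : {subset meds <= unzip1 s}.
  move=> b; have : {subset flatten (groups (unzip1 s)) <= unzip1 s}.
    by move=> a; rewrite flatten_groups; exact: mem_take.
  elim: hmeds => // g b' gs ms [g_b' _] _ IH sub; rewrite inE => /predU1P[->|].
    by apply: sub; rewrite /= mem_cat g_b'.
  by apply: IH => a ha; apply: sub; rewrite /= mem_cat ha orbT.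
have count_s (P : pred addr) :
    (count P (flatten (groups (unzip1 s))) <= count (fun p => P p.1) s)%N.
  rewrite flatten_groups -[X in (_ <= X)%N](count_map fst P s).
  rewrite -[X in (_ <= count P X)%N](cat_take_drop (size (unzip1 s) %/ 5 * 5)).
  by rewrite count_cat leq_addr.
apply: (spec_weaken (hrec m3 x (fun=> 1) _ zero zero 0 0 _ _ (g3 _ _ h0)
  (g3 _ _ h0) _ _)).
- by rewrite size_map size_meds q_gt0.
- exact: rd1 (grows_trans g2 g3) (g3 _ _ h1) sub_meds.
- by rewrite add0r.
- by rewrite add0r.
- by rewrite size_map size_meds.
- move=> a m4 _ [+ /balanced_half[]].
  rewrite /unzip1 -map_comp map_id size_meds => meds_a c1 c2.
  split; first exact: sub_meds.
  + have : (3 * count (fun b => (x a <= x b)%R) meds <=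
        count (fun b => (x a <= x b)%R) (flatten (groups (unzip1 s))))%N.
      apply: (@count_medians (fun y z => y <= z)); first
        by move=> z t; apply: le_trans.
      by elim: hmeds => [|g b gs ms [_ [hb _]] _ IH]; constructor.
    by have := count_s (fun b => x a <= x b); lia.
  + have : (3 * count (fun b => (x b <= x a)%R) meds <=
        count (fun b => (x b <= x a)%R) (flatten (groups (unzip1 s))))%N.
      apply: (@count_medians (fun y z => z <= y)); first
        by move=> z t zy tz; apply: le_trans zy.
      by elim: hmeds => [|g b gs ms [_ [_ hb]] _ IH]; constructor.
    by have := count_s (fun b => x b <= x a); lia.
Qed.

(** The linear-time selection theorem: the quality of the pivot bounds each open
    side by [size s - 3 * q / 2], which closes the recurrence explained at
    [cost]. *)
Lemma wselect_selects fuel : selects (wselect fuel) fuel.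
Proof.
elim: fuel => [|f IH] m x u s al ar l r /andP[s_gt0 s_le] rd hl hr le_l le_r;
  first by lia.
rewrite /cost /=; case: (leqP (size s) 5) => [small|big].
  have sa : head 0%N (unzip1 s) \in unzip1 s
    by case: (s) s_gt0 => //= p t _; exact: mem_head.
  apply: (spec_bind (t1 := 0) (Q1 := fun a _ => a = head 0%N (unzip1 s)) _ _
    (leqnn _)).
    exact: spec_ret.
  move=> _ m1 g1 ->.
  (* The pivot itself is on neither of its open sides. *)
  have lt_s (P : rel R) : irreflexive P ->
      (count (fun p => P (x p.1) (x (head 0%N (unzip1 s)))) s < size s)%N.
    move=> irr; rewrite -size_filter.
    apply: (@size_filter_lt (fun z => P z (x (head 0%N (unzip1 s)))) x s _ sa).
    by rewrite irr.
  have := lt_s (fun y z => y < z) (@ltxx _ R).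
  have := lt_s (fun y z => z < y) (@ltxx _ R).
  move=> c1 c2.
  apply: (spec_narrow IH s_le (readable_grows g1 rd) (g1 _ _ hl) (g1 _ _ hr)) => //.
  - by rewrite /cost ifT; [nia | lia].
  - by rewrite /cost ifT; [nia | lia].
set q := (size s %/ 5)%N.
apply: (spec_bind (t2 := (6 * size s + (288 * size s - 432 * q))%N)
  (spec_median_of_medians IH _ rd)).
- by rewrite big.
- move=> a m1 g1 [sa]; rewrite -/q => c1 c2.
  have e1 := count_predC (fun p => (x a <= x p.1)%R) s.
  have e2 := count_predC (fun p => (x p.1 <= x a)%R) s.
  have {}e1 : (count (fun p => (x a <= x p.1)%R) s +
      count (fun p => (x p.1 < x a)%R) s = size s)%N.
    by rewrite -e1; congr (_ + _)%N; apply: eq_count => p /=; rewrite ltNge.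
  have {}e2 : (count (fun p => (x p.1 <= x a)%R) s +
      count (fun p => (x a < x p.1)%R) s = size s)%N.
    by rewrite -e2; congr (_ + _)%N; apply: eq_count => p /=; rewrite ltNge.
  apply: (spec_narrow IH s_le (readable_grows g1 rd) (g1 _ _ hl) (g1 _ _ hr)) => //.
  + have := cost_le (count (fun p => (x p.1 < x a)%R) s); lia.
  + have := cost_le (count (fun p => (x a < x p.1)%R) s); lia.
- have := cost_le q; rewrite -/q /q; lia.
Qed.

Lemma spec_wmedian m x u s : (0 < size s)%N -> readable m x u s ->
  (forall p, p \in s -> 0 <= u p.2) ->
  spec (wmedian_prog s) m (288 * size s)
    (fun a m' => holds m' a (x a) /\ balanced x u s 0 0 (x a)).
Proof.
move=> s_gt0 rd u_ge0.
apply: (spec_bind (spec_lit 0 m) _ (leqnn _)) => zero m1 g1 h0.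
have m_ge0 : 0 <= mass x u xpredT s.
  by rewrite /mass big_seq_cond; apply: sumr_ge0 => p; rewrite andbT; exact: u_ge0.
apply: spec_weaken (wselect_selects _ (readable_grows g1 rd) h0 h0 _ _) _ _.
- by rewrite s_gt0 leqnn.
- by rewrite add0r.
- by rewrite add0r.
- exact: cost_le.
- move=> a m2 g2 [/mapP[p s_p ->] bal]; split=> //.
  by apply: g2; apply: g1; case: (rd p s_p).
Qed.
End Selection.

(** * Cost of one iteration and of the whole run *)

Section Pcm.
Variable R : realType.
Implicit Types m : seq R.

Lemma spec_abs_diff a b x y m : holds m a x -> holds m b y ->
  spec (abs_diff_prog a b) m 2 (fun c m' => holds m' c `|x - y|).
Proof.
move=> ha hb; apply: (spec_bind (spec_less ha hb) _ (leqnn _)) => _ m' g ->.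
case: ltP => [lt_xy|le_yx].
- rewrite distrC ger0_norm ?subr_ge0 1?ltW //.
  exact: (spec_op Defs.Sub (g _ _ hb) (g _ _ ha)).
- rewrite ger0_norm ?subr_ge0 //.
  exact: (spec_op Defs.Sub (g _ _ ha) (g _ _ hb)).
Qed.

Lemma spec_d1 n (ax ay : 'I_n -> addr) (x y : 'rV[R]_n) m :
  (forall j, holds m (ax j) (x 0 j)) -> (forall j, holds m (ay j) (y 0 j)) ->
  spec (d1_prog ax ay) m (3 * n) (fun a m' => holds m' a (d1 x y)).
Proof.
move=> hx hy.
have := @spec_sum R _ (fun j => abs_diff_prog (ax j) (ay j))
  (fun j => `|x 0 j - y 0 j|) 2 (enum 'I_n) m _.
rewrite size_enum_ord mulnC big_enum; apply=> j m' _ g.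
by apply: spec_abs_diff; exact: g.
Qed.

Lemma spec_power_product K anu nu (ad : 'I_K -> addr) (d : 'I_K -> R) k m :
  holds m anu nu -> (forall j, holds m (ad j) (d j)) ->
  spec (power_product_prog anu ad k) m (2 * K)
    (fun a m' => holds m' a (\prod_(j | j != k) d j `^ nu)).
Proof.
move=> hnu hd.
have := @spec_prod R _ (fun j => op Pow (ad j) anu) (fun j => d j `^ nu) 1
  [seq j <- enum 'I_K | j != k] m _.
rewrite big_filter big_enum_cond => /(_ _)/spec_weaken; apply=> //.
- by move=> j m' _ g; exact: (spec_op Pow (g _ _ (hd j)) (g _ _ hnu)).
- rewrite mulnC leq_mul2l /= size_filter.
  by apply: leq_trans (count_size _ _) _; rewrite size_enum_ord.
Qed.

(** The [K] products of the denominator, each of [O(K)] operations, give the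
    quadratic cost. *)
Lemma spec_power_prob n K anu nu (ad : 'I_K -> addr) (c : 'I_K -> 'rV[R]_n) k
    (x : 'rV[R]_n) m :
  holds m anu nu -> (forall j, holds m (ad j) (d1 x (c j))) ->
  spec (power_prob_prog anu ad k) m (6 * K ^ 2)
    (fun a m' => holds m' a (power_prob nu c k x)).
Proof.
move=> hnu hd.
apply: (spec_bind (t2 := (K * (2 * K).+1 + 1)%N)
  (spec_power_product k hnu hd)); last first.
  by case: K k {c ad hd} => [[]//|K'] _; nia.
move=> num m1 g1 hnum.
have hden (l : 'I_K) m' : l \in enum 'I_K -> grows m1 m' ->
    spec (power_product_prog anu ad l) m' (2 * K)
      (fun a m'' => holds m'' a (\prod_(j | j != l) d1 x (c j) `^ nu)).
  move=> _ g'; apply: spec_power_product => [|j]; apply: g'; exact: g1.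
apply: (spec_bind (t2 := 1%N) (spec_sum hden)); last by rewrite size_enum_ord.
move=> den m2 g2; rewrite big_enum => hden2.
exact: (spec_op Div (g2 _ _ hnum) hden2).
Qed.

Lemma power_prob_ge0 n K nu (c : 'I_K -> 'rV[R]_n) k x : 0 <= power_prob nu c k x.
Proof.
apply: divr_ge0; first by apply: prodr_ge0 => j _; exact: powR_ge0.
by apply: sumr_ge0 => l _; apply: prodr_ge0 => j _; exact: powR_ge0.
Qed.

(** The slacks are solved from their sum, the mass [E] at [y], and their
    difference, that of the masses on the two sides. *)
Lemma balanced_weighted_median N (x u : 'I_N -> R) y :
  \sum_(i | x i < y) u i <= \sum_(i | y <= x i) u i ->
  \sum_(i | y < x i) u i <= \sum_(i | x i <= y) u i ->
  weighted_median x u y.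
Proof.
have -> : \sum_(i | y <= x i) u i =
    \sum_(i | x i == y) u i + \sum_(i | y < x i) u i.
  rewrite (bigID (fun i => x i == y)) /=.
  congr (_ + _); apply: eq_bigl => i; last by rewrite lt_neqAle andbC eq_sym.
  by case: eqP => [->|_]; rewrite ?lexx ?andbF.
have -> : \sum_(i | x i <= y) u i =
    \sum_(i | x i == y) u i + \sum_(i | x i < y) u i.
  rewrite (bigID (fun i => x i == y)) /=.
  congr (_ + _); apply: eq_bigl => i; last by rewrite lt_neqAle andbC.
  by case: eqP => [->|_]; rewrite ?lexx ?andbF.
rewrite /weighted_median; set E := \sum_(i | x i == y) u i.
set A := \sum_(i | x i < y) u i; set B := \sum_(i | y < x i) u i => h1 h2.
by exists ((E + B - A) / 2), ((E + A - B) / 2); split; lra.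
Qed.

Section Data.
Variables (n N K : nat) (X : 'I_N -> 'rV[R]_n) (w : 'I_N -> R).
Variables (aX : 'I_N -> 'I_n -> addr) (aw : 'I_N -> addr).
Hypotheses (K_gt0 : (0 < K)%N) (N_gt0 : (0 < N)%N) (w_gt0 : forall i, 0 < w i).

Definition data_in m : Prop :=
  (forall i j, holds m (aX i j) (X i 0 j)) /\ (forall i, holds m (aw i) (w i)).

Definition centers_in m (ac : 'I_K -> 'I_n -> addr) (c : 'I_K -> 'rV[R]_n) :=
  forall k j, holds m (ac k j) (c k 0 j).

(** The address-based description of the points is instantiated with the contents
    of the memory at the start of the search. *)
Lemma spec_wmedian_points m (ax au : 'I_N -> addr) (x u : 'I_N -> R) :
  (forall i, holds m (ax i) (x i)) -> (forall i, holds m (au i) (u i)) ->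
  (forall i, 0 <= u i) ->
  spec (wmedian_prog [seq (ax i, au i) | i <- enum 'I_N]) m (288 * N)
    (fun a m' => exists2 y, holds m' a y & weighted_median x u y).
Proof.
move=> hx hu u_ge0; set s := map _ _.
have size_s : size s = N by rewrite size_map size_enum_ord.
pose val (a : addr) := m`_a.
have vx i : val (ax i) = x i := holds_nth (hx i).
have vu i : val (au i) = u i := holds_nth (hu i).
have massE (P : pred R) : mass val val P s = \sum_(i | P (x i)) u i.
  rewrite /mass big_map big_enum_cond; apply: eq_big => i; first by rewrite vx.
  by rewrite vu.
have := @spec_wmedian R m val val s; rewrite size_s => /(_ N_gt0) h.
apply: spec_weaken (h _ _) _ _ => //.
- by move=> _ /mapP[i _ ->]; rewrite /= vx vu; split; [exact: hx | exact: hu].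
- by move=> _ /mapP[i _ ->]; rewrite /= vu; exact: u_ge0.
- move=> a m' _ [ha]; rewrite /balanced !massE !add0r => -[h1 h2].
  by exists (val a) => //; exact: balanced_weighted_median.
Qed.

(** Of the coefficient [291] of [n], [3] comes from the distances and [288] from
    the medians. *)
Lemma spec_center_update m anu nu ac c :
  data_in m -> holds m anu nu -> centers_in m ac c ->
  spec (center_update_prog wmedian_prog aX aw anu ac) m
    (N * K * (291 * n + 6 * K ^ 2 + 1))
    (fun ac' m' =>
       exists2 c', centers_in m' ac' c' & center_update X w nu c c').
Proof.
move=> [hX hw] hnu hc.
rewrite (_ : (_ * _)%N = #|{: 'I_N * 'I_K}| * (3 * n) +
  (#|{: 'I_N * 'I_K}| * (6 * K ^ 2) +
  (#|{: 'I_N * 'I_K}| * 1 + (#|{: 'I_K * 'I_n}| * (288 * N) + 0))))%N; last first.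
  by rewrite !card_prod !card_ord; ring.
apply: (spec_bind (spec_table (Q := fun ik a m' =>
  holds m' a (d1 (X ik.1) (c ik.2))) _ _) _ (leqnn _)).
- by move=> t a m1 m2 g; exact: g.
- by move=> ik m' g; apply: spec_d1 => j; exact: g.
move=> ad m1 g1 hd.
apply: (spec_bind (spec_table (Q := fun ik a m' =>
  holds m' a (power_prob nu c ik.2 (X ik.1))) _ _) _ (leqnn _)).
- by move=> t a m2 m3 g; exact: g.
- move=> ik m' g; apply: spec_power_prob => [|j]; first by apply: g; exact: g1.
  by apply: g; exact: hd (_, _).
move=> ap m2 g2 hp.
apply: (spec_bind (spec_table (Q := fun ik a m' =>
  holds m' a (w ik.1 * power_prob nu c ik.2 (X ik.1))) _ _) _ (leqnn _)).
- by move=> t a m3 m4 g; exact: g.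
- move=> ik m' g; apply: (spec_op Mul _ (g _ _ (hp ik))).
  by apply: g; apply: g2; apply: g1.
move=> au m3 g3 hu.
have gm := grows_trans g1 (grows_trans g2 g3).
apply: (spec_bind (spec_table (Q := fun kj a m' =>
  exists2 y, holds m' a y & weighted_median (fun i => X i 0 kj.2)
    (fun i => w i * power_prob nu c kj.1 (X i)) y) _ _) _ (leqnn _)).
- by move=> t a m4 m5 g [y hy wm]; exists y => //; exact: g.
- move=> kj m' g; apply: spec_wmedian_points => i.
  + by apply: g; exact: gm.
  + by apply: g; exact: hu (_, _).
  + by apply: mulr_ge0; [exact: ltW | exact: power_prob_ge0].
move=> ac' m4 g4 hac'; apply: spec_ret.
exists (fun k => \row_j m4`_(ac' (k, j))) => k j; have [y hy wm] := hac' (k, j).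
- by rewrite mxE (holds_nth hy).
- by rewrite mxE (holds_nth hy).
Qed.

Variables (eps Delta : R) (aeps aDelta : addr).

(** The constant absorbs the cost of an update and of the stopping test,
    whose [O(K * n)] operations are dominated because [N] and [K] are positive. *)
Lemma ensures_pcm maxit m anu nu ac c :
  data_in m -> holds m aeps eps -> holds m aDelta Delta ->
  holds m anu nu -> centers_in m ac c ->
  ensures (pcm_prog wmedian_prog aX aw aeps aDelta maxit anu ac) m
    (fun out m' t =>
       [/\ exists2 c', centers_in m' (centers out) c' &
             pcm_run X w eps Delta nu c (iterations out) (halted out) c',
           halted out \/ iterations out = maxit &
           (t <= 300 * (N * K * (K ^ 2 + n) * iterations out))%N]).
Proof.
elim: maxit m anu nu ac c => [|maxit IH] m anu nu ac c hdata heps hDelta hnu hc.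
  apply: ensures_ret; split=> /=; last by rewrite muln0.
  - by exists c => //; constructor.
  - by right.
apply: ensures_bind (spec_center_update hdata hnu hc) _ =>
  ac' m1 t1 g1 [le1 [c' hc' up]].
have hdist (k : 'I_K) m' : k \in enum 'I_K -> grows m1 m' ->
    spec (d1_prog (ac' k) (ac k)) m' (3 * n)
      (fun a m'' => holds m'' a (d1 (c' k) (c k))).
  by move=> _ g; apply: spec_d1 => j; apply: g => //; exact: g1.
apply: ensures_bind (spec_sum hdist) _ => sum m2 t2 g2'.
rewrite size_enum_ord big_enum => -[le2 hsum].
have g2 := grows_trans g1 g2'.
apply: ensures_bind (spec_less hsum (g2 _ _ heps)) _ => _ m3 t3 g3' [le3 ->].
have g3 := grows_trans g2 g3'.
have le_t : (t1 + t2 + t3 + 1 <= 300 * (N * K * (K ^ 2 + n)))%N.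
  have NK_ge : (K <= N * K)%N by rewrite leq_pmull.
  have NKK_ge : (N * K <= N * K * K ^ 2)%N
    by rewrite leq_pmulr // expn_gt0 K_gt0.
  have NKn_ge : (K * n <= N * K * n)%N by rewrite leq_mul2r NK_ge orbT.
  move: le1 le2 NK_ge NKK_ge NKn_ge; rewrite !mulnDr mulnS; nia.
case: ifPn => [halt|go].
  apply: ensures_ret; split=> /=; last by rewrite muln1; lia.
  - exists c'; last exact: run_stop.
    by move=> k j; apply: g3'; apply: g2'; exact: hc'.
  - by left.
apply: ensures_bind (spec_op Add (g3 _ _ hnu) (g3 _ _ hDelta)) _ =>
  anu' m4 t4 g4' [le4 hnu'].
have g4 := grows_trans g3 g4'.
have hdata4 : data_in m4 by case: hdata => h1 h2; split=> *; exact: g4.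
have hc4 : centers_in m4 ac' c'.
  by move=> k j; apply: g4'; apply: g3'; apply: g2'; exact: hc'.
apply: ensures_bind (IH m4 anu' _ _ _ hdata4 (g4 _ _ heps) (g4 _ _ hDelta)
  hnu' hc4) _.
move=> out m5 t5 g5 [[c'' hc'' run] stop le5].
apply: ensures_ret; split=> /=.
- by exists c'' => //; exact: run_continue go run.
- by case: stop => [->|->]; [left | right].
- by rewrite mulnS mulnDr; lia.
Qed.

End Data.
End Pcm.

Theorem corollary1 (R : realType) :
  exists (wmed : seq (addr * addr) -> prog addr) (C : nat),
  forall (n N K : nat) (X : 'I_N -> 'rV[R]_n) (w : 'I_N -> R)
    (eps nu0 Delta : R) (c0 : 'I_K -> 'rV[R]_n),
  (1 <= K)%N -> (K <= N)%N -> (forall i, 0 < w i) ->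
  0 < eps -> 1 <= nu0 -> 0 < Delta ->
  forall (m : seq R) (aX : 'I_N -> 'I_n -> addr) (aw : 'I_N -> addr)
    (aeps anu0 aDelta : addr) (ac0 : 'I_K -> 'I_n -> addr),
  (forall i j, holds m (aX i j) (X i 0 j)) -> (forall i, holds m (aw i) (w i)) ->
  holds m aeps eps -> holds m anu0 nu0 -> holds m aDelta Delta ->
  (forall k j, holds m (ac0 k j) (c0 k 0 j)) ->
  forall maxit : nat,
  let P := pcm_prog wmed aX aw aeps aDelta maxit anu0 ac0 in
  let out := result P m in
  (exists c : 'I_K -> 'rV[R]_n,
     (forall k j, holds (memory P m) (centers out k j) (c k 0 j)) /\
     pcm_run X w eps Delta nu0 c0 (iterations out) (halted out) c) /\
  (halted out \/ iterations out = maxit) /\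
  (time P m <= C * (N * K * (K ^ 2 + n) * iterations out))%N.
Proof.
exists wmedian_prog, 300%N => n N K X w eps nu0 Delta c0 K_gt0 le_KN w_gt0 _ _ _.
move=> m aX aw aeps anu0 aDelta ac0 hX hw heps hnu hDelta hc maxit P out.
have N_gt0 : (0 < N)%N := leq_trans K_gt0 le_KN.
have [_ [[c hc' run] stop le_t]] :=
  ensures_pcm K_gt0 N_gt0 w_gt0 maxit (conj hX hw) heps hDelta hnu hc.
by split; [exists c | split].
Qed.
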